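(* The class of all $U$-coalgebras induced by an abstract logic is a covariety. That is, it is closed under homomorphic images, subcoalgebras and sums in $\mathsf{Coalg}(U)$: (i) if $(X,\alpha)$ is a $U$-coalgebra induced by an abstract logic and $f:(X,\alpha)\to(Y,\beta)$ is a surjective homomorphism of $U$-coalgebras, then $(Y,\beta)$ is induced by an abstract logic; (ii) if $(Y,\beta)$ is a $U$-coalgebra induced by an abstract logic and $f:(X,\alpha)\to(Y,\beta)$ is an injective homomorphism of $U$-coalgebras, then $(X,\alpha)$ is induced by an abstract logic; (iii) if $(X_i,\alpha_i)_{i\in I}$ is a family of $U$-coalgebras (indexed by a set $I$), each induced by an abstract logic, then the sum (coproduct) of this family in $\mathsf{Coalg}(U)$ is induced by an abstract logic.
   Context: For a set $X$, $PX$ denotes its powerset. A consequence relation $\vdash$ on $X$ is a relation $\vdash$ from $PX$ to $X$ such that for all $A,B\subseteq X$ and $x\in X$: (1) if $x\in A$ then $A\vdash x$; (2) if $A\vdash x$ and $A\subseteq B$ then $B\vdash x$; (3) if $A\vdash y$ for all $y\in B$ and $B\vdash x$, then $A\vdash x$. The pair $(X,\vdash)$ is called an abstract logic. The up-set functor $U:\mathsf{Set}\to\mathsf{Set}$ sends a set $X$ to $UX=\{\mathcal{A}\subseteq PX\mid \mathcal{A}\text{ is up-closed}\}$ (up-closed: $A\in\mathcal{A}$ and $A\subseteq B\subseteq X$ imply $B\in\mathcal{A}$), and a function $f:X\to Y$ to $Uf:UX\to UY$, $Uf(\mathcal{A})=\{B\subseteq Y\mid f^{-1}(B)\in\mathcal{A}\}$.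 A $U$-coalgebra is a pair $(X,\alpha)$ with $X$ a set and $\alpha:X\to UX$ a function. A homomorphism $f:(X,\alpha)\to(Y,\beta)$ of $U$-coalgebras is a function $f:X\to Y$ with $Uf\cdot\alpha=\beta\cdot f$. $\mathsf{Coalg}(U)$ is the category of $U$-coalgebras and homomorphisms. The sum of a family $(X_i,\alpha_i)_{i\in I}$ in $\mathsf{Coalg}(U)$ is the disjoint union $\coprod_{i\in I}X_i$ equipped with the unique coalgebra structure making all the coproduct injections homomorphisms. A $U$-coalgebra $(X,\alpha)$ is induced by an abstract logic if there is a consequence relation $\vdash$ on $X$ such that $\alpha(x)=\{A\subseteq X\mid A\vdash x\}$ for all $x\in X$. *)

(* Defs.v *)
From mathcomp Require Import all_boot.
From mathcomp Require Import boolp classical_sets.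

Set Implicit Arguments.
Unset Strict Implicit.
Unset Printing Implicit Defensive.

Local Open Scope classical_set_scope.

(* [ent A x] is read "A entails x". *)
Record consequence (X : Type) (ent : set X -> X -> Prop) : Prop := Consequence {
  cons_refl : forall A x, A x -> ent A x;
  cons_mono : forall A B x, ent A x -> A `<=` B -> ent B x;
  cons_cut : forall A B x, (forall y, B y -> ent A y) -> ent B x -> ent A x
}.

Definition up_closed (X : Type) (F : set (set X)) : Prop :=
  forall A B : set X, F A -> A `<=` B -> F B.

Record upset (X : Type) : Type := Upset {
  upset_sets : set (set X);
  upset_up : up_closed upset_sets
}.

Lemma upset_eq (X : Type) (F G : upset X) :
  upset_sets F = upset_sets G -> F = G.
Proof.
by case: F G => [F uF] [G uG] /= E; subst G; congr Upset; apply: Prop_irrelevance.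
Qed.

Lemma Umap_up (X Y : Type) (f : X -> Y) (F : upset X) :
  up_closed [set B : set Y | upset_sets F (f @^-1` B)].
Proof.
move=> A B FA AB; apply: (@upset_up _ F _ _ FA).
exact: preimage_subset.
Qed.

Definition Umap (X Y : Type) (f : X -> Y) (F : upset X) : upset Y :=
  Upset (@Umap_up X Y f F).

Lemma Umap_id (X : Type) (F : upset X) : Umap id F = F.
Proof. exact: upset_eq. Qed.

Lemma Umap_comp (X Y Z : Type) (f : X -> Y) (g : Y -> Z) (F : upset X) :
  Umap (g \o f) F = Umap g (Umap f F).
Proof. exact: upset_eq. Qed.

(* Coalgebras for the up-set functor [upset], [Umap]. *)
Record coalg : Type := Coalg {
  carrier :> Type;
  str : carrier -> upset carrier
}.

Definition coalg_hom (X Y : coalg) (f : X -> Y) : Prop :=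
  forall x : X, Umap f (str x) = str (f x).

Definition sum_inj (I : Type) (X : I -> coalg) (i : I) (x : X i) :
  {i : I & X i} := existT (fun i => carrier (X i)) i x.

(* On the i-th summand the structure is U(in_i) o alpha_i, the only choice for
   which every injection is a homomorphism (see [sum_str_unique]). *)
Definition sum_coalg (I : Type) (X : I -> coalg) : coalg :=
  @Coalg {i : I & X i} (fun u => Umap (sum_inj (i := projT1 u)) (str (projT2 u))).

Lemma sum_inj_hom (I : Type) (X : I -> coalg) (i : I) :
  @coalg_hom (X i) (sum_coalg X) (sum_inj (i := i)).
Proof. by []. Qed.

Lemma sum_str_unique (I : Type) (X : I -> coalg)
    (g : {i : I & X i} -> upset {i : I & X i}) :
  (forall i, @coalg_hom (X i) (Coalg g) (sum_inj (i := i))) ->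
  g = @str (sum_coalg X).
Proof. by move=> gH; apply: funext => -[i x]; rewrite -[LHS](gH i x). Qed.

Lemma sum_coalg_universal (I : Type) (X : I -> coalg) (Z : coalg)
    (h : forall i, X i -> Z) :
  (forall i, coalg_hom (h i)) ->
  exists! k : sum_coalg X -> Z,
    coalg_hom k /\ forall i x, k (sum_inj (i := i) x) = h i x.
Proof.
move=> hH; exists (fun u => h (projT1 u) (projT2 u)); split.
  by split=> // -[i x]; rewrite /= -Umap_comp -hH.
by move=> k [_ kE]; apply: funext => -[i x]; rewrite -kE.
Qed.

Definition induced_by_logic (X : coalg) : Prop :=
  exists2 ent : set X -> X -> Prop, consequence ent &
    forall x : X, upset_sets (str x) = [set A | ent A x].

Definition closed_images (K : coalg -> Prop) : Prop :=
  forall (X Y : coalg) (f : X -> Y),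
    coalg_hom f -> (forall y, exists x, f x = y) -> K X -> K Y.

(* Up to isomorphism, a subcoalgebra is the domain of an injective
   homomorphism. *)
Definition closed_subcoalgs (K : coalg -> Prop) : Prop :=
  forall (X Y : coalg) (f : X -> Y),
    coalg_hom f -> injective f -> K Y -> K X.

Definition closed_sums (K : coalg -> Prop) : Prop :=
  forall (I : Type) (X : I -> coalg), (forall i, K (X i)) -> K (sum_coalg X).

Definition covariety (K : coalg -> Prop) : Prop :=
  [/\ closed_images K, closed_subcoalgs K & closed_sums K].

(* Main.v *)
Require Import Defs.
From mathcomp Require Import all_boot.
From mathcomp Require Import boolp classical_sets.

Set Implicit Arguments.
Unset Strict Implicit.
Unset Printing Implicit Defensive.

Local Open Scope classical_set_scope.

(** The structure map of a coalgebra already determines the only relation that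
    can induce it, so being induced by a logic means that this relation is a
    consequence relation ([induced_by_logicE]).  Along a homomorphism [f] this
    relation satisfies: [B] entails [f x] iff the preimage of [B] entails [x]
    ([entails_hom]).

    Taking preimages preserves membership and families of entailments, so each
    instance of reflexivity or cut whose conclusion is at [f x] pulls back to
    an instance at [x].  Hence the laws hold on any coalgebra covered by
    homomorphisms from coalgebras in the class ([induced_by_logic_cover]); a
    surjection is such a cover by one map, and the injections into a sum are
    such a cover.  For an injective [f], every [A] is the preimage of its own
    image, so instances of the laws on the domain push forward instead. *)

Definition entails (X : coalg) (A : set X) (x : X) : Prop :=
  upset_sets (str x) A.

Lemma entails_hom (X Y : coalg) (f : X -> Y) (B : set Y) (x : X) :
  coalg_hom f -> entails B (f x) = entails (f @^-1` B) x.
Proof. by move=> fH; rewrite /entails -fH. Qed.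

Lemma induced_by_logicE (X : coalg) :
  induced_by_logic X <-> consequence (@entails X).
Proof.
split=> [[ent cent strE]|cX]; last by exists (@entails X).
suff -> : @entails X = ent by [].
by apply: funext => A; apply: funext => x; rewrite /entails strE.
Qed.

(** Monotonicity is the up-closure of the values of the structure map; only
    reflexivity and cut constrain the coalgebra. *)
Lemma consequence_entails (X : coalg) :
  (forall (A : set X) x, A x -> entails A x) ->
  (forall (A B : set X) x,
     (forall y, B y -> entails A y) -> entails B x -> entails A x) ->
  consequence (@entails X).
Proof. by move=> refl cut; split=> // A B x Ax AB; apply: upset_up Ax AB. Qed.

(** Common source of closure under homomorphic images and under sums: each law
    concerns one conclusion at a time, so it can be checked in whichever member
    of the cover reaches that conclusion. *)
Lemma induced_by_logic_cover (I : Type) (X : I -> coalg) (Y : coalg)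
    (f : forall i, X i -> Y) :
  (forall i, coalg_hom (f i)) -> (forall y, exists i x, f i x = y) ->
  (forall i, induced_by_logic (X i)) -> induced_by_logic Y.
Proof.
move=> fH cover KX; apply/induced_by_logicE.
have cX i : consequence (@entails (X i)) by apply/induced_by_logicE.
apply: consequence_entails => [A y|A B y].
  have [i [x <-]] := cover y; rewrite entails_hom // => Afx.
  exact: cons_refl (cX i) _ _ Afx.
have [i [x <-]] := cover y; rewrite !entails_hom // => AB.
apply: (cons_cut (cX i)) => z Bfz.
by rewrite -entails_hom //; apply: AB.
Qed.

Lemma preimage_image_inj (S T : Type) (f : S -> T) (A : set S) :
  injective f -> f @^-1` (f @` A) = A.
Proof.
move=> f_inj; apply/seteqP; split=> x /=; first by case=> z Az /f_inj <-.
by move=> Ax; exists x.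
Qed.

Lemma entails_image (X Y : coalg) (f : X -> Y) (A : set X) (x : X) :
  coalg_hom f -> injective f -> entails (f @` A) (f x) = entails A x.
Proof. by move=> fH f_inj; rewrite entails_hom // preimage_image_inj. Qed.

Lemma induced_by_logic_sub (X Y : coalg) (f : X -> Y) :
  coalg_hom f -> injective f -> induced_by_logic Y -> induced_by_logic X.
Proof.
move=> fH f_inj /induced_by_logicE cY; apply/induced_by_logicE.
apply: consequence_entails => [A x Ax|A B x AB].
  by rewrite -(entails_image _ _ fH) //; apply: (cons_refl cY); exists x.
rewrite -!(entails_image _ _ fH) //; apply: (cons_cut cY) => _ [z Bz <-].
by rewrite entails_image //; apply: AB.
Qed.

Theorem theorem13 : covariety induced_by_logic.
Proof.
split=> [X Y f fH f_surj KX | X Y f | I X KX].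
- by apply: (@induced_by_logic_cover unit (fun=> X) Y (fun=> f)).
- exact: induced_by_logic_sub.
- apply: (induced_by_logic_cover (@sum_inj_hom I X)) => // -[i x].
  by exists i, x.
Qed.
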